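(* If the inverse semigroup $\Gamma$ satisfies condition (L), then $G_u(\Gamma)$ is Hausdorff.
   Context: In an inverse semigroup, $x\prec y$ means $xy^{-1}=xx^{-1}$ (natural partial order); then $x$ is called a precessor of $y$. The symbol $0$ denotes the (unique) element $z$ with $z\prec x$ for all $x$, if it exists; conditions of the form ''$\neq 0$'' are vacuous if there is no such element. Condition (L): any $x,y\in\Gamma$ having a common precessor not equal to zero have a largest common precessor. A subset $A\subset\Gamma$ is directed if it is nonempty and any two elements of $A$ have a common $\prec$-lower bound in $A$. For directed sets write $A\prec B$ if for every $b\in B$ there is $a\in A$ with $a\prec b$, and $A\sim B$ if $A\prec B$ and $B\prec A$. $\mathcal{O}(\Gamma)$ is the set of $\sim$-classes $[A]$ of directed sets; with $[A][B]=[AB]$ and $[A]^{-1}=[A^{-1}]$ (elementwise) it is an inverse semigroup whose natural order is $[A]\prec[B]\iff A\prec B$. For $x\in\Gamma$ write $x$ also for $[\{x\}]$. $G_u(\Gamma)$ is the groupoid with underlying set $\mathcal{O}(\Gamma)$, the inversion of $\mathcal{O}(\Gamma)$, and product $XY$ defined iff $X^{-1}X=YY^{-1}$. For $x\in\Gamma$, $U_x=\{X\in G_u(\Gamma):X\prec x\}$; for $x_1,\ldots,x_n\prec x$ ($n\ge0$), $U_{x;x_1,\ldots,x_n}=U_x\cap U_{x_1}^c\cap\cdots\cap U_{x_n}^c$. The topology on $G_u(\Gamma)$ is the one with basis the sets $U_{x;x_1,\ldots,x_n}$. *)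

(* Defs.v *)
From HB Require Import structures.
From mathcomp Require Import all_boot all_classical topology.
From mathcomp Require Import generic_quotient.

Set Implicit Arguments.
Unset Strict Implicit.
Unset Printing Implicit Defensive.

Local Open Scope quotient_scope.
Local Open Scope classical_set_scope.
Local Open Scope group_scope.

(* The library's [monoid.inv] is only available on structures with a unit,
   hence a separate operation. *)
HB.mixin Record Semigroup_isInverse G of Semigroup G := {
  sinv : G -> G;
  mulgVK : forall x : G, x * sinv x * x = x;
  mulVgV : forall x : G, sinv x * x * sinv x = sinv x;
  sinv_uniq : forall x y : G, x * y * x = x -> y * x * y = y -> y = sinv x
}.

#[short(type="invSemigroupType")]
HB.structure Definition InvSemigroup :=
  {G of Semigroup_isInverse G & Semigroup G}.

Local Notation "x ^-1" := (sinv x) : group_scope.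

Definition natle (G : invSemigroupType) (x y : G) : Prop :=
  x * y^-1 = x * x^-1.

Local Notation "x ≺ y" := (natle x y) (at level 70, no associativity).

Definition is_zero (G : invSemigroupType) (z : G) : Prop := forall x : G, z ≺ x.

Definition common_precessor (G : invSemigroupType) (x y z : G) : Prop :=
  z ≺ x /\ z ≺ y.

(* If G has no zero element then [~ is_zero z] holds for every z. *)
Definition condition_L (G : invSemigroupType) : Prop :=
  forall x y : G,
    (exists2 z, common_precessor x y z & ~ is_zero z) ->
    exists2 m, common_precessor x y m &
      forall z, common_precessor x y z -> z ≺ m.

Section InvSemigroupTheory.
Variable G : invSemigroupType.
Implicit Types x y z e f : G.

Lemma sinvK x : x^-1^-1 = x.
Proof. by apply/esym/sinv_uniq; [exact: mulVgV|exact: mulgVK]. Qed.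

Lemma sinv_idem e : e * e = e -> e^-1 = e.
Proof. by move=> ee; apply/esym/sinv_uniq; rewrite !ee. Qed.

Lemma idemM_idem e f : e * e = e -> f * f = f -> (e * f) * (e * f) = e * f.
Proof.
move=> ee ff; set x := (e * f)^-1.
have A1 : e * f * x * (e * f) = e * f by exact: mulgVK.
have A2 : x * (e * f) * x = x by exact: mulVgV.
have xE : f * x * e = x.
  apply: sinv_uniq.
    have -> : e * f * (f * x * e) * (e * f) =
      e * (f * f) * x * ((e * e) * f) by rewrite !mulgA.
    by rewrite ee ff A1.
  have -> : f * x * e * (e * f) * (f * x * e) =
    f * (x * ((e * e) * (f * f)) * x) * e by rewrite !mulgA.
  by rewrite ee ff A2.
have xx : x * x = x.
  have -> : x * x = f * (x * (e * f) * x) * e by rewrite -{1 2}xE !mulgA.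
  by rewrite A2 xE.
have -> : e * f = x by rewrite -[e * f]sinvK -/x sinv_idem.
exact: xx.
Qed.

Lemma idemC e f : e * e = e -> f * f = f -> e * f = f * e.
Proof.
move=> ee ff.
have efi := idemM_idem ee ff; have fei := idemM_idem ff ee.
have -> : f * e = (e * f)^-1; last by rewrite sinv_idem.
apply: sinv_uniq.
  have -> : e * f * (f * e) * (e * f) = e * (f * f) * ((e * e) * f).
    by rewrite !mulgA.
  by rewrite ee ff efi.
have -> : f * e * (e * f) * (f * e) = f * (e * e) * ((f * f) * e).
  by rewrite !mulgA.
by rewrite ee ff fei.
Qed.

Lemma idem_mulgV x : (x * x^-1) * (x * x^-1) = x * x^-1.
Proof. by rewrite !mulgA mulgVK. Qed.

Lemma idem_mulVg x : (x^-1 * x) * (x^-1 * x) = x^-1 * x.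
Proof. by rewrite !mulgA mulVgV. Qed.

Lemma sinvM x y : (x * y)^-1 = y^-1 * x^-1.
Proof.
have C := idemC (idem_mulVg x) (idem_mulgV y).
apply/esym/sinv_uniq.
  have -> : x * y * (y^-1 * x^-1) * (x * y) =
     x * ((y * y^-1) * (x^-1 * x)) * y by rewrite !mulgA.
  by rewrite -C !mulgA mulgVK -[in RHS](mulgVK y) !mulgA.
have -> : y^-1 * x^-1 * (x * y) * (y^-1 * x^-1) =
     y^-1 * ((x^-1 * x) * (y * y^-1)) * x^-1 by rewrite !mulgA.
by rewrite C !mulgA mulVgV -!(mulgA y^-1) mulVgV.
Qed.

Lemma natle_idemr x f : f * f = f -> x * f ≺ x.
Proof.
move=> ff; rewrite /natle sinvM (sinv_idem ff) !mulgA.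
by rewrite -(mulgA x f f) ff.
Qed.

Lemma natleE x y : x ≺ y -> x = x * x^-1 * y.
Proof.
move=> xy.
have C := idemC (idem_mulVg x) (idem_mulVg y).
have yx : y * x^-1 = x * x^-1.
  by rewrite -(sinv_idem (idem_mulgV x)) -xy sinvM sinvK.
rewrite -{1}xy.
have -> : x * y^-1 * y = x * ((x^-1 * x) * (y^-1 * y)).
  by rewrite !mulgA mulgVK.
rewrite C.
have -> : x * (y^-1 * y * (x^-1 * x)) = x * y^-1 * (y * x^-1) * x.
  by rewrite !mulgA.
by rewrite yx xy idem_mulgV mulgVK.
Qed.

Lemma natleP x y : x ≺ y <-> exists2 f, f * f = f & x = y * f.
Proof.
split=> [/natleE xE|[f ff ->]]; last exact: natle_idemr.
have C := idemC (idem_mulgV x) (idem_mulgV y).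
exists (y^-1 * (x * x^-1) * y).
  have -> : y^-1 * (x * x^-1) * y * (y^-1 * (x * x^-1) * y) =
    y^-1 * (x * x^-1 * (y * y^-1)) * (x * x^-1) * y by rewrite !mulgA.
  rewrite C.
  have -> : y^-1 * (y * y^-1 * (x * x^-1)) * (x * x^-1) * y =
    (y^-1 * y * y^-1) * ((x * x^-1) * (x * x^-1)) * y by rewrite !mulgA.
  by rewrite mulVgV idem_mulgV.
have -> : y * (y^-1 * (x * x^-1) * y) = (y * y^-1) * (x * x^-1) * y.
  by rewrite !mulgA.
by rewrite -C -mulgA mulgVK -xE.
Qed.

Lemma natle_refl x : x ≺ x.
Proof. by []. Qed.

Lemma natle_trans y x z : x ≺ y -> y ≺ z -> x ≺ z.
Proof.
move=> /natleP[e ee ->] /natleP[f ff ->]; rewrite -mulgA; apply: natle_idemr.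
exact: idemM_idem.
Qed.

Lemma natleV x y : x ≺ y -> x^-1 ≺ y^-1.
Proof.
move=> /natleE xE; apply/natleP; exists (x * x^-1); first exact: idem_mulgV.
by rewrite {1}xE sinvM sinvM sinvK.
Qed.

Lemma natle_mul2l x y z : x ≺ y -> z * x ≺ z * y.
Proof.
by move=> /natleP[f ff ->]; apply/natleP; exists f => //; rewrite mulgA.
Qed.

Lemma natle_mul2r x y z : x ≺ y -> x * z ≺ y * z.
Proof.
move=> /natleV/(natle_mul2l z^-1)/natleV.
by rewrite !sinvM !sinvK.
Qed.

Lemma natle_mul x y z t : x ≺ y -> z ≺ t -> x * z ≺ y * t.
Proof.
move=> xy zt; apply: (natle_trans (natle_mul2l x zt)).
exact: natle_mul2r.
Qed.

Lemma natle_idem_mul e x : e * e = e -> e * x ≺ x.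
Proof.
move=> ee; rewrite -[e * x]sinvK -[X in _ ≺ X]sinvK; apply: natleV.
by rewrite sinvM (sinv_idem ee); exact: natle_idemr.
Qed.

(* Two elements below a common element have the meet [z * z^-1 * w]. *)
Lemma meet_lel x z w : z ≺ x -> w ≺ x -> z * z^-1 * w ≺ z.
Proof.
move=> /natleE zE /natleP[f ff ->]; rewrite mulgA -zE.
exact: natle_idemr.
Qed.

Lemma meet_ler z w : z * z^-1 * w ≺ w.
Proof. by apply: natle_idem_mul => //; exact: idem_mulgV. Qed.

Lemma meet_glb z w v : v ≺ z -> v ≺ w -> v ≺ z * z^-1 * w.
Proof.
move=> vz vw; rewrite [X in X ≺ _](natleE vw); apply: natle_mul2r.
by apply: natle_mul => //; exact: natleV.
Qed.

End InvSemigroupTheory.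

(* Regularity, an anti-involution and commuting projections x x^* force unique
   inverses; used to make O(Gamma) an inverse semigroup. *)
Section RegularStar.
Variables (S : semigroupType) (inv : S -> S).
Hypothesis invK : involutive inv.
Hypothesis invM : {morph inv : x y / x * y >-> y * x}.
Hypothesis mulVK : forall x, x * inv x * x = x.
Hypothesis projC : forall x y,
  (x * inv x) * (y * inv y) = (y * inv y) * (x * inv x).

Let VmulV x : inv x * x * inv x = inv x.
Proof. by rewrite -{2}(invK x) mulVK. Qed.

Let idem_proj e : e * e = e -> e = e * inv e.
Proof.
move=> ee.
have iee : inv e * inv e = inv e by rewrite -invM ee.
have eE : inv e = (inv e * e) * (e * inv e).
  by rewrite mulgA -(mulgA _ e e) ee VmulV.
have : inv e = e.
  have C := projC (inv e) e; rewrite invK in C.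
  by rewrite eE C !mulgA -(mulgA e) iee mulVK.
by move=> eV; rewrite eV ee.
Qed.

Lemma star_idemC (e f : S) : e * e = e -> f * f = f -> e * f = f * e.
Proof. by move=> /idem_proj-> /idem_proj->. Qed.

Lemma star_uniq (x y : S) : x * y * x = x -> y * x * y = y -> y = inv x.
Proof.
move=> xyx yxy.
have i1 z : x * z * x = x -> (x * z) * (x * z) = x * z.
  by move=> h; rewrite mulgA h.
have i2 z : x * z * x = x -> (z * x) * (z * x) = z * x.
  by move=> h; rewrite -!mulgA (mulgA x) h.
have C1 := star_idemC (i1 _ xyx) (i1 _ (mulVK x)).
have C2 := star_idemC (i2 _ xyx) (i2 _ (mulVK x)).
have yx : y * x = inv x * x.
  have -> : y * x = (y * x) * (inv x * x) by rewrite -{1}(mulVK x) !mulgA.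
  by rewrite C2 -mulgA (mulgA x) xyx.
have xy : x * y = x * inv x.
  have -> : x * y = (x * inv x) * (x * y) by rewrite mulgA mulVK.
  by rewrite -C1 mulgA xyx.
by rewrite -yxy yx -mulgA xy mulgA VmulV.
Qed.

End RegularStar.

Section Directed.
Variable G : invSemigroupType.
Implicit Types A B C : set G.

Definition is_directed A : Prop :=
  A !=set0 /\
  forall a b, A a -> A b -> exists2 c, A c & c ≺ a /\ c ≺ b.

Definition dle A B : Prop := forall b, B b -> exists2 a, A a & a ≺ b.

Definition setM A B : set G := [set a * b | a in A & b in B].

Definition setV A : set G := [set a^-1 | a in A].

Lemma dle_refl A : dle A A.
Proof. by move=> a Aa; exists a. Qed.

Lemma dle_trans B A C : dle A B -> dle B C -> dle A C.
Proof.
move=> AB BC c /BC[b /AB[a Aa ab] bc]; exists a => //; exact: natle_trans bc.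
Qed.

Lemma dleM A A' B B' : dle A A' -> dle B B' -> dle (setM A B) (setM A' B').
Proof.
move=> AA BB _ [a' /AA[a Aa aa] [b' /BB[b Bb bb] <-]].
by exists (a * b); [exists a => //; exists b|exact: natle_mul].
Qed.

Lemma dleV A B : dle A B -> dle (setV A) (setV B).
Proof.
move=> AB _ [b /AB[a Aa ab] <-].
by exists a^-1; [exists a|exact: natleV].
Qed.

Lemma is_directedM A B : is_directed A -> is_directed B -> is_directed (setM A B).
Proof.
move=> [[a Aa] dA] [[b Bb] dB]; split.
  by exists (a * b), a => //; exists b.
move=> _ _ [a1 Aa1 [b1 Bb1 <-]] [a2 Aa2 [b2 Bb2 <-]].
have [c Ac [c1 c2]] := dA _ _ Aa1 Aa2.
have [d Bd [d1 d2]] := dB _ _ Bb1 Bb2.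
exists (c * d); first by exists c => //; exists d.
by split; exact: natle_mul.
Qed.

Lemma is_directedV A : is_directed A -> is_directed (setV A).
Proof.
move=> [[a Aa] dA]; split; first by exists a^-1, a.
move=> _ _ [a1 Aa1 <-] [a2 Aa2 <-].
have [c Ac [c1 c2]] := dA _ _ Aa1 Aa2.
by exists c^-1; [exists c|split; exact: natleV].
Qed.

Lemma is_directed1 (x : G) : is_directed [set x].
Proof. by split; [exists x|move=> _ _ -> ->; exists x]. Qed.

Definition directed_set : Type := {A : set G | `[< is_directed A >]}.
HB.instance Definition _ := Choice.on directed_set.

Lemma directed_setP (A : directed_set) : is_directed (val A).
Proof. by case: A => A /= /asboolP. Qed.

Definition DSet A (dA : is_directed A) : directed_set := exist _ A (asboolT dA).

Definition dsim (A B : directed_set) : bool :=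
  `[< dle (val A) (val B) /\ dle (val B) (val A) >].

Lemma dsim_refl : reflexive dsim.
Proof. by move=> A; apply/asboolP; split; exact: dle_refl. Qed.

Lemma dsim_sym : symmetric dsim.
Proof. by move=> A B; apply/asboolP/asboolP => -[]. Qed.

Lemma dsim_trans : transitive dsim.
Proof.
move=> B A C /asboolP[AB BA] /asboolP[BC CB]; apply/asboolP.
by split; [exact: dle_trans BC|exact: dle_trans BA].
Qed.

Canonical dsim_equiv := EquivRel dsim dsim_refl dsim_sym dsim_trans.

(* O(Gamma) *)
Definition dclass : Type := {eq_quot dsim_equiv}.
HB.instance Definition _ := Choice.on dclass.
HB.instance Definition _ := EqQuotient.on dclass.

Definition directedM (A B : directed_set) : directed_set :=
  DSet (is_directedM (directed_setP A) (directed_setP B)).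
Definition directedV (A : directed_set) : directed_set :=
  DSet (is_directedV (directed_setP A)).

Definition dclass_mul (X Y : dclass) : dclass :=
  \pi_dclass (directedM (repr X) (repr Y)).
Definition dclass_inv (X : dclass) : dclass := \pi_dclass (directedV (repr X)).

Lemma dclass_eqP (A B : directed_set) :
  \pi_dclass A = \pi_dclass B <-> dle (val A) (val B) /\ dle (val B) (val A).
Proof.
split=> [/eqmodP/asboolP//|AB].
by apply/eqmodP; exact/asboolP.
Qed.

Lemma dclass_mulE (A B : directed_set) :
  dclass_mul (\pi_dclass A) (\pi_dclass B) = \pi_dclass (directedM A B).
Proof.
have /dclass_eqP[A1 A2] := reprK (\pi_dclass A).
have /dclass_eqP[B1 B2] := reprK (\pi_dclass B).
by apply/dclass_eqP; split; exact: dleM.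
Qed.

Lemma dclass_invE (A : directed_set) :
  dclass_inv (\pi_dclass A) = \pi_dclass (directedV A).
Proof.
have /dclass_eqP[A1 A2] := reprK (\pi_dclass A).
by apply/dclass_eqP; split; exact: dleV.
Qed.

Lemma dclassP (X : dclass) : exists A : directed_set, X = \pi_dclass A.
Proof. by exists (repr X); rewrite reprK. Qed.

Lemma dclass_mulA : associative dclass_mul.
Proof.
move=> X Y Z; have [A ->] := dclassP X; have [B ->] := dclassP Y.
have [C ->] := dclassP Z; rewrite !dclass_mulE; apply/dclass_eqP => /=.
suff -> : setM (val A) (setM (val B) (val C)) = setM (setM (val A) (val B)) (val C).
  by split; exact: dle_refl.
apply/seteqP; split=> t.
- move=> [a Aa [_ [b Bb [c Cc <-]] <-]]; exists (a * b).
    by exists a => //; exists b.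
  by exists c => //; rewrite mulgA.
- move=> [_ [a Aa [b Bb <-]] [c Cc <-]]; exists a => //.
  by exists (b * c); [exists b => //; exists c|rewrite mulgA].
Qed.

HB.instance Definition _ := isSemigroup.Build dclass dclass_mulA.

Let dclass_invK : involutive dclass_inv.
Proof.
move=> X; have [A ->] := dclassP X; rewrite !dclass_invE; apply/dclass_eqP => /=.
split=> [a Aa|_ [_ [a Aa <-] <-]].
  by exists a => //; exists a^-1; [exists a|rewrite sinvK].
by exists a => //; rewrite sinvK.
Qed.

Let dclass_invM : {morph dclass_inv : x y / x * y >-> y * x}.
Proof.
move=> X Y; have [A ->] := dclassP X; have [B ->] := dclassP Y.
rewrite /mul/= !(dclass_mulE, dclass_invE); apply/dclass_eqP => /=.
split=> [_ [_ [b Bb <-] [_ [a Aa <-] <-]]|_ [_ [a Aa [b Bb <-]] <-]].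
  exists (a * b)^-1; last by rewrite sinvM.
  by exists (a * b) => //; exists a => //; exists b.
exists (b^-1 * a^-1); last by rewrite sinvM.
by exists b^-1; [exists b|exists a^-1; [exists a|]].
Qed.

Let dclass_mulVK (X : dclass) : X * dclass_inv X * X = X.
Proof.
have [A ->] := dclassP X; rewrite /mul/= !(dclass_mulE, dclass_invE).
have [_ dA] := directed_setP A; apply/dclass_eqP => /=; split.
  move=> a Aa; exists (a * a^-1 * a); last by rewrite mulgVK.
  by exists (a * a^-1); [exists a => //; exists a^-1 => //; exists a|exists a].
move=> _ [_ [a Aa [_ [b Ab <-] <-]] [c Ac <-]].
have [d Ad [da db]] := dA _ _ Aa Ab; have [e Ae [ed ec]] := dA _ _ Ad Ac.
exists e => //; rewrite -(mulgVK e); apply: natle_mul => //.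
by apply: natle_mul; [|apply: natleV]; exact: natle_trans ed _.
Qed.

Let dclass_projC (X Y : dclass) :
  (X * dclass_inv X) * (Y * dclass_inv Y) = (Y * dclass_inv Y) * (X * dclass_inv X).
Proof.
have [A ->] := dclassP X; have [B ->] := dclassP Y.
rewrite /mul/= !(dclass_mulE, dclass_invE).
suff le C D : is_directed C -> is_directed D ->
    dle (setM (setM C (setV C)) (setM D (setV D)))
        (setM (setM D (setV D)) (setM C (setV C))).
  by apply/dclass_eqP => /=; split; apply: le; exact: directed_setP.
move=> [_ dC] [_ dD] _ [_ [d1 D1 [_ [d2 D2 <-] <-]] [_ [c1 C1 [_ [c2 C2 <-] <-]] <-]].
have [c Cc [cc1 cc2]] := dC _ _ C1 C2; have [d Dd [dd1 dd2]] := dD _ _ D1 D2.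
exists ((c * c^-1) * (d * d^-1)).
  exists (c * c^-1); first by exists c => //; exists c^-1 => //; exists c.
  by exists (d * d^-1) => //; exists d => //; exists d^-1 => //; exists d.
rewrite (idemC (idem_mulgV c) (idem_mulgV d)).
by do 2 apply: natle_mul; do ?apply: natleV.
Qed.

Let dclass_VmulV (X : dclass) : dclass_inv X * X * dclass_inv X = dclass_inv X.
Proof. by rewrite -{2}(dclass_invK X) dclass_mulVK. Qed.

HB.instance Definition _ := Semigroup_isInverse.Build dclass
  dclass_mulVK dclass_VmulV
  (star_uniq dclass_invK dclass_invM dclass_mulVK dclass_projC).

Lemma dclass_natleP (A B : directed_set) :
  (\pi_dclass A : dclass) ≺ \pi_dclass B <-> dle (val A) (val B).
Proof.
have [[a0 Aa0] dA] := directed_setP A; have [[b0 Bb0] dB] := directed_setP B.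
split=> [/natleE|AB].
  rewrite /mul/sinv/= !(dclass_mulE, dclass_invE) => /dclass_eqP[+ _] b Bb.
  move=> /(_ (a0 * a0^-1 * b))[|a Aa ab].
    by exists (a0 * a0^-1); [exists a0 => //; exists a0^-1 => //; exists a0|exists b].
  by exists a => //; exact: natle_trans ab (meet_ler _ _).
rewrite /natle /mul/sinv/= !(dclass_mulE, dclass_invE); apply/dclass_eqP => /=.
split; last by apply: dleM; [exact: dle_refl|exact: dleV].
move=> _ [a1 Aa1 [_ [a2 Aa2 <-] <-]].
have [a Aa [aa1 aa2]] := dA _ _ Aa1 Aa2.
have [a' Aa' a'b] := AB _ Bb0; have [c Ac [ca ca']] := dA _ _ Aa Aa'.
exists (c * b0^-1); first by exists c => //; exists b0^-1 => //; exists b0.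
rewrite (natle_trans ca' a'b).
by apply: natle_mul; [|apply: natleV]; exact: natle_trans ca _.
Qed.

Definition dprincipal (x : G) : dclass := \pi_dclass (DSet (is_directed1 x)).

End Directed.

(* The universal groupoid: an alias of O(Gamma) carrying the topology; its
   inversion is that of O(Gamma) and its partial product is [Gu_mul]. *)
Definition Gu (G : invSemigroupType) : Type := dclass G.
HB.instance Definition _ (G : invSemigroupType) := InvSemigroup.on (Gu G).

Section UniversalGroupoid.
Variable G : invSemigroupType.
Implicit Types (x y z : G) (X Y : Gu G).

Definition Gu_inv X : Gu G := X^-1.

Definition Gu_mul X Y : option (Gu G) :=
  if X^-1 * X == Y * Y^-1 then Some (X * Y) else None.

Definition Gu_U x : set (Gu G) := [set X | X ≺ (dprincipal x : Gu G)].

Definition Gu_basic x (s : seq G) : set (Gu G) :=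
  Gu_U x `&` \bigcap_(y in [set` s]) ~` Gu_U y.

Definition Gu_basis : set (set (Gu G)) :=
  [set V | exists x (s : seq G), (forall y, y \in s -> y ≺ x) /\ V = Gu_basic x s].

Lemma Gu_UP x (A : directed_set G) :
  Gu_U x (\pi_(dclass G) A) <-> exists2 a, val A a & a ≺ x.
Proof.
split=> [/dclass_natleP/(_ x)|[a Aa ax]]; first exact.
by apply/dclass_natleP => _ ->; exists a.
Qed.

Let Gu_cover : \bigcup_(V in Gu_basis) V = setT.
Proof.
apply/seteqP; split=> // X _; have [A ->] := dclassP X.
have [[a Aa] _] := directed_setP A; exists (Gu_basic a [::]).
  by exists a, [::].
by split=> //; apply/Gu_UP; exists a.
Qed.

Let Gu_join (V W : set (Gu G)) X : Gu_basis V -> Gu_basis W -> V X -> W X ->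
  exists K, [/\ Gu_basis K, K X & K `<=` V `&` W].
Proof.
move=> [x [s [sx ->]]] [y [t [ty ->]]]; have [A ->] := dclassP X.
move=> [/Gu_UP[a Aa ax] As] [/Gu_UP[b Ab yb] At].
have [_ /(_ _ _ Aa Ab)[z Az [za zb]]] := directed_setP A.
have zx := natle_trans za ax; have zy := natle_trans zb yb.
exists (Gu_basic z [seq z * z^-1 * w | w <- s ++ t]); split.
- exists z, [seq z * z^-1 * w | w <- s ++ t]; split=> // _ /mapP[w + ->].
  by rewrite mem_cat => /orP[/sx|/ty]; exact: meet_lel.
- split; first by apply/Gu_UP; exists z.
  move=> _ /= /mapP[w + ->] /Gu_UP[c Ac cm].
  have Aw : Gu_U w (\pi_(dclass G) A).
    by apply/Gu_UP; exists c => //; exact: natle_trans cm (meet_ler _ _).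
  by rewrite mem_cat => /orP[/As|/At].
- move=> Y; have [B ->] := dclassP Y.
  move=> [/Gu_UP[c Bc cz] Bm].
  have Bn w : w \in s ++ t -> ~ Gu_U w (\pi_(dclass G) B).
    move=> wst /Gu_UP[d Bd dw].
    have [_ /(_ _ _ Bc Bd)[e Be [ec ed]]] := directed_setP B.
    apply: (Bm (z * z^-1 * w)); first by apply/mapP; exists w.
    by apply/Gu_UP; exists e => //; apply: meet_glb;
      [exact: natle_trans ec cz|exact: natle_trans ed dw].
  split; split.
  + by apply/Gu_UP; exists c => //; exact: natle_trans cz zx.
  + by move=> w /= ws; apply: Bn; rewrite mem_cat ws.
  + by apply/Gu_UP; exists c => //; exact: natle_trans cz zy.
  + by move=> w /= wt; apply: Bn; rewrite mem_cat wt orbT.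
Qed.

HB.instance Definition _ := isBaseTopological.Build (Gu G) Gu_cover Gu_join.

End UniversalGroupoid.

(* Main.v *)
(** Let [X] not be below [Y]: some [y] lies above [Y] but not above [X], and we
    take any [x] above [X]. If [x] and [y] have no common precessor, then [U_x]
    and [U_y] are disjoint. Otherwise (L) yields a largest common precessor [m],
    and [U_{x;m}] and [U_y] separate [X] from [Y]. *)
Require Import Defs.
From mathcomp Require Import all_boot all_classical topology.

Set Implicit Arguments.
Unset Strict Implicit.
Unset Printing Implicit Defensive.

Local Open Scope classical_set_scope.

(* The nonzero hypothesis in (L) is harmless: a zero common precessor is
   itself the largest one when all of them are zero. *)
Lemma condition_L_meet (G : invSemigroupType) (x y z : G) :
  condition_L G -> common_precessor x y z ->
  exists2 m, common_precessor x y m &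
    forall w, common_precessor x y w -> natle w m.
Proof.
move=> LG xyz.
have [nz|az] := pselect (exists2 w, common_precessor x y w & ~ is_zero w).
  exact: LG.
exists z => // w xyw; have [w0|wn0] := pselect (is_zero w); first exact: w0.
by case: az; exists w.
Qed.

Section GuSeparation.
Variable G : invSemigroupType.
Implicit Types (x y : G) (X Y : Gu G).

Lemma Gu_natle_anti X Y : natle X Y -> natle Y X -> X = Y.
Proof.
have [A ->] := dclassP X; have [B ->] := dclassP Y.
by move=> /dclass_natleP AB /dclass_natleP BA; apply/dclass_eqP.
Qed.

(** For the converse: if [B] represents [Y], then [Y] lies in [U_b] for every [b] in [B], and [X] in
    [U_b] means that a representative of [X] has an element below [b]. *)
Lemma Gu_natleP X Y : natle X Y <-> forall y, Gu_U y Y -> Gu_U y X.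
Proof.
split=> [XY y|]; first exact: natle_trans.
have [A ->] := dclassP X; have [B ->] := dclassP Y => UBA.
apply/dclass_natleP => b Bb; apply/Gu_UP/UBA/Gu_UP.
by exists b.
Qed.

Lemma Gu_U_neq0 X : exists x, Gu_U x X.
Proof.
have [A ->] := dclassP X; have [[a Aa] _] := directed_setP A.
by exists a; apply/Gu_UP; exists a.
Qed.

(** Directedness: elements below [x] and below [y] have a lower bound in the same representative. *)
Lemma Gu_U_precessor x y X : Gu_U x X -> Gu_U y X ->
  exists2 z, common_precessor x y z & Gu_U z X.
Proof.
have [A ->] := dclassP X => /Gu_UP[a Aa ax] /Gu_UP[b Ab yb].
have [_ /(_ _ _ Aa Ab)[c Ac [ca cb]]] := directed_setP A.
exists c; last by apply/Gu_UP; exists c.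
by split; [exact: natle_trans ca ax|exact: natle_trans cb yb].
Qed.

Lemma Gu_U_natle x y X : natle x y -> Gu_U x X -> Gu_U y X.
Proof.
have [A ->] := dclassP X => xy /Gu_UP[a Aa ax].
by apply/Gu_UP; exists a => //; exact: natle_trans xy.
Qed.

Lemma nbhs_Gu_basic x (s : seq G) X :
  (forall y, y \in s -> natle y x) -> Gu_basic x s X -> nbhs X (Gu_basic x s).
Proof.
move=> sx Xxs; rewrite nbhsE; exists (Gu_basic x s) => //; split=> //.
exists [set Gu_basic x s]; first by move=> _ ->; exists x, s.
by rewrite bigcup_set1.
Qed.

Lemma nbhs_Gu_U x X : Gu_U x X -> nbhs X (Gu_U x).
Proof.
move=> Xx; have <- : Gu_basic x [::] = Gu_U x.
  by apply/seteqP; split=> [Y []|Y xY] //; split.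
by apply: nbhs_Gu_basic => //; split.
Qed.

Lemma cluster_natle X Y : condition_L G -> cluster (nbhs X) Y -> natle X Y.
Proof.
move=> LG clXY; apply/Gu_natleP => y Yy; apply: contrapT => nXy.
have [x Xx] := Gu_U_neq0 X.
have [Z [/Gu_U_precessor Zx /Zx[z xyz _]]] :=
  clXY _ _ (nbhs_Gu_U Xx) (nbhs_Gu_U Yy).
have [m [mx my] mmax] := condition_L_meet LG xyz.
(* [X] avoids [U_m], since [m ≺ y] would put it in [U_y]. *)
have nbhsX : nbhs X (Gu_basic x [:: m]).
  apply: nbhs_Gu_basic => [w|]; first by rewrite inE => /eqP ->.
  by split=> // w /=; rewrite inE => /eqP -> /(Gu_U_natle my).
(* [W] is below a common precessor of [x] and [y], hence below [m], which [Wm] forbids. *)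
have [W [[Wx Wm] /(Gu_U_precessor Wx)[w xyw Ww]]] := clXY _ _ nbhsX (nbhs_Gu_U Yy).
by apply: (Wm m); [rewrite /= inE|exact: Gu_U_natle (mmax _ xyw) Ww].
Qed.

End GuSeparation.

Theorem corollary4p10 (G : invSemigroupType) :
  condition_L G -> hausdorff_space (Gu G).
Proof.
(* Clustering is symmetric in [X] and [Y], so both inequalities follow. *)
move=> LG X Y clXY; apply: Gu_natle_anti; apply: cluster_natle => //.
by move=> V W XV YW; rewrite setIC; exact: clXY.
Qed.
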